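(* Let $A\in\mathbb{R}^{n\times n}$, $B\in\mathbb{R}^{n\times m}$ with $(A,B)$ stabilizable, $Q\succ0$, $R\succ0$, $\gamma,\eta\ge0$, $x_k\in\mathbb{R}^n$, and let $\tilde P,V,J_k,P_1,q_1,r_1$ be as in the context. For every $\alpha>1$, the problem (P1) — minimize over $F_k\in\mathbb{R}^{m\times n}$, $\delta_k$ the objective $-\delta_k+\gamma\|F_k\|_0+\eta\|F_kx_k\|_0$ subject to $J_k(F_k,\xi;x_k)\le\alpha\big(V(x_k)-V(x(t_k+\xi))\big)$ for all $\xi\in[0,\delta_k]$ — and its relaxation (P3) — minimize over $f_k\in\mathbb{R}^{mn}$, $\delta_k$ the objective $-\delta_k+\gamma\|f_k\|_1+\eta\|(x_k^T\otimes I)f_k\|_1$ subject to $\tfrac12f_k^TP_1(\xi)f_k+q_1(\xi)^Tf_k+r_1(\xi)\le0$ for all $\xi\in[0,\delta_k]$ — are feasible.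
   Context: $\tilde F$ is a fixed gain with $A+B\tilde F$ Hurwitz and $\tilde P\succ0$ solves $(A+B\tilde F)^T\tilde P+\tilde P(A+B\tilde F)+Q+\tilde F^TR\tilde F=0$; $V(x):=x^T\tilde Px$. $x(t_k+\xi)$ is the solution of $\dot x=Ax+Bu$ from $x(t_k)=x_k$ with held input $u=F_kx_k$, and $J_k(F_k,\xi;x_k):=\int_{t_k}^{t_k+\xi}(x^TQx+u^TRu)dt$. $Z(\tau):=\int_0^\tau e^{-As}ds$, $H_0(\xi):=\int_0^\xi e^{A^T\tau}Qe^{A\tau}d\tau$, $H_1(\xi):=\int_0^\xi e^{A^T\tau}Qe^{A\tau}Z(\tau)Bd\tau$, $H_2(\xi):=\int_0^\xi(e^{A\tau}Z(\tau)B)^TQ(e^{A\tau}Z(\tau)B)d\tau+\xi R$; $P_1(\xi):=2(x_kx_k^T)\otimes(H_2(\xi)+\alpha B^TZ(\xi)^Te^{A^T\xi}\tilde Pe^{A\xi}Z(\xi)B)$, $q_1(\xi):=2\mathrm{vec}((H_1(\xi)^T+\alpha B^TZ(\xi)^Te^{A^T\xi}\tilde Pe^{A\xi})x_kx_k^T)$, $r_1(\xi):=x_k^T(H_0(\xi)+\alpha(e^{A^T\xi}\tilde Pe^{A\xi}-\tilde P))x_k$; $f_k=\mathrm{vec}(F_k)$. $\|\cdot\|_0$ counts nonzero entries and $\|\cdot\|_1$ sums absolute values of entries. *)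

(* Defs.v *)
From HB Require Import structures.
From mathcomp Require Import all_boot all_order all_algebra.
From mathcomp Require Import all_classical all_reals all_analysis.
From mathcomp Require Import complex mxtens.
Set Implicit Arguments. Unset Strict Implicit. Unset Printing Implicit Defensive.
Import Order.TTheory GRing.Theory Num.Theory numFieldTopology.Exports numFieldNormedType.Exports.
Local Open Scope ring_scope.

Definition posdef {R : realType} {n : nat} (M : 'M[R]_n) : Prop :=
  M^T = M /\ forall v : 'cV[R]_n, v != 0 -> 0 < (v^T *m M *m v) 0 0.

Definition hurwitz {R : realType} {n : nat} (M : 'M[R]_n) : Prop :=
  forall z : R[i], root (char_poly (map_mx (real_complex R) M)) z ->
    complex.Re z < 0.

Definition stabilizable {R : realType} {n m : nat}
  (A : 'M[R]_n) (B : 'M[R]_(n, m)) : Prop :=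
  exists F : 'M[R]_(m, n), hurwitz (A + B *m F).

Definition expm {R : realType} {n : nat} (M : 'M[R]_n) : 'M[R]_n :=
  \matrix_(i, j) limn (fun N => (\sum_(k < N) (k`!%:R)^-1 *: M ^+ k) i j).

Definition mxint {R : realType} {p q : nat} (a b : R)
  (F : R -> 'M[R]_(p, q)) : 'M[R]_(p, q) :=
  \matrix_(i, j) Rintegral lebesgue_measure `[a, b]%classic (fun s => F s i j).

(* column-stacking vec of an m x n matrix, consistent with the Kronecker
   product  *t  of mxtens (index (j, i) |-> j * m + i) *)
Definition vec {R : realType} {m n : nat} (F : 'M[R]_(m, n)) : 'cV[R]_(n * m) :=
  \matrix_(k, l) F (mxtens_unindex k).2 (mxtens_unindex k).1.

Definition Vfun {R : realType} {n : nat} (Pt : 'M[R]_n) (x : 'cV[R]_n) : R :=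
  (x^T *m Pt *m x) 0 0.

(* x is the solution of xdot = A x + B u on R with x(0) = x0 (time shifted so
   that t_k = 0; the system is time-invariant) *)
Definition is_traj {R : realType} {n m : nat} (A : 'M[R]_n) (B : 'M[R]_(n, m))
  (u : 'cV[R]_m) (x0 : 'cV[R]_n) (x : R -> 'cV[R]_n) : Prop :=
  x 0 = x0 /\
  forall (t : R) (i : 'I_n),
    is_derive t 1 (fun s => x s i 0) ((A *m x t + B *m u) i 0).

Definition Jcost {R : realType} {n m : nat} (Q : 'M[R]_n) (Rw : 'M[R]_m)
  (u : 'cV[R]_m) (x : R -> 'cV[R]_n) (xi : R) : R :=
  Rintegral lebesgue_measure `[0, xi]%classic
    (fun t : R => ((x t)^T *m Q *m x t + u^T *m Rw *m u) 0 0).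

Definition Zmx {R : realType} {n : nat} (A : 'M[R]_n) (tau : R) : 'M[R]_n :=
  mxint 0 tau (fun s => expm ((- s) *: A)).

Definition Emx {R : realType} {n : nat} (A : 'M[R]_n) (t : R) : 'M[R]_n :=
  expm (t *: A).

Definition H0 {R : realType} {n : nat} (A Q : 'M[R]_n) (xi : R) : 'M[R]_n :=
  mxint 0 xi (fun tau => (Emx A tau)^T *m Q *m Emx A tau).

Definition H1 {R : realType} {n m : nat} (A : 'M[R]_n) (B : 'M[R]_(n, m))
  (Q : 'M[R]_n) (xi : R) : 'M[R]_(n, m) :=
  mxint 0 xi (fun tau => (Emx A tau)^T *m Q *m Emx A tau *m Zmx A tau *m B).

Definition H2 {R : realType} {n m : nat} (A : 'M[R]_n) (B : 'M[R]_(n, m))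
  (Q : 'M[R]_n) (Rw : 'M[R]_m) (xi : R) : 'M[R]_m :=
  mxint 0 xi (fun tau => (Emx A tau *m Zmx A tau *m B)^T *m Q
                          *m (Emx A tau *m Zmx A tau *m B))
  + xi *: Rw.

Definition P1 {R : realType} {n m : nat} (A : 'M[R]_n) (B : 'M[R]_(n, m))
  (Q : 'M[R]_n) (Rw : 'M[R]_m) (Pt : 'M[R]_n) (alpha : R) (xk : 'cV[R]_n)
  (xi : R) : 'M[R]_(n * m) :=
  2%:R *: ((xk *m xk^T) *t
    (H2 A B Q Rw xi
     + alpha *: ((B^T *m (Zmx A xi)^T *m (Emx A xi)^T) *m Pt
                 *m (Emx A xi *m Zmx A xi *m B)))).

Definition q1 {R : realType} {n m : nat} (A : 'M[R]_n) (B : 'M[R]_(n, m))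
  (Q : 'M[R]_n) (Pt : 'M[R]_n) (alpha : R) (xk : 'cV[R]_n)
  (xi : R) : 'cV[R]_(n * m) :=
  2%:R *: vec (((H1 A B Q xi)^T
                + alpha *: (B^T *m (Zmx A xi)^T *m (Emx A xi)^T *m Pt *m Emx A xi))
               *m (xk *m xk^T)).

Definition r1 {R : realType} {n : nat} (A Q Pt : 'M[R]_n) (alpha : R)
  (xk : 'cV[R]_n) (xi : R) : R :=
  (xk^T *m (H0 A Q xi + alpha *: ((Emx A xi)^T *m Pt *m Emx A xi - Pt)) *m xk) 0 0.

Definition norm0 {R : realType} {p q : nat} (M : 'M[R]_(p, q)) : nat :=
  #|[set ij : 'I_p * 'I_q | M ij.1 ij.2 != 0]|.
Definition norm1 {R : realType} {p q : nat} (M : 'M[R]_(p, q)) : R :=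
  \sum_(i < p) \sum_(j < q) `|M i j|.

Definition obj_P1 {R : realType} {n m : nat} (gamma eta : R) (xk : 'cV[R]_n)
  (F : 'M[R]_(m, n)) (delta : R) : R :=
  - delta + gamma * (norm0 F)%:R + eta * (norm0 (F *m xk))%:R.
Definition obj_P3 {R : realType} {n m : nat} (gamma eta : R) (xk : 'cV[R]_n)
  (f : 'cV[R]_(n * m)) (delta : R) : R :=
  - delta + gamma * norm1 f + eta * norm1 ((xk^T *t (1%:M : 'M[R]_m)) *m f).

Definition feasible_P1 {R : realType} {n m : nat} (A : 'M[R]_n) (B : 'M[R]_(n, m))
  (Q : 'M[R]_n) (Rw : 'M[R]_m) (Pt : 'M[R]_n) (alpha : R) (xk : 'cV[R]_n) : Prop :=
  exists (F : 'M[R]_(m, n)) (delta : R), 0 < delta /\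
    forall x : R -> 'cV[R]_n, is_traj A B (F *m xk) xk x ->
    forall xi : R, 0 <= xi <= delta ->
      Jcost Q Rw (F *m xk) x xi <= alpha * (Vfun Pt xk - Vfun Pt (x xi)).

Definition feasible_P3 {R : realType} {n m : nat} (A : 'M[R]_n) (B : 'M[R]_(n, m))
  (Q : 'M[R]_n) (Rw : 'M[R]_m) (Pt : 'M[R]_n) (alpha : R) (xk : 'cV[R]_n) : Prop :=
  exists (f : 'cV[R]_(n * m)) (delta : R), 0 < delta /\
    forall xi : R, 0 <= xi <= delta ->
      ((2%:R)^-1 *: (f^T *m P1 A B Q Rw Pt alpha xk xi *m f)
       + (q1 A B Q Pt alpha xk xi)^T *m f) 0 0
      + r1 A Q Pt alpha xk xi <= 0.

(* Main.v *)
(* With the fallback gain u = Ft xk the sampled-data state is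
   phi(t) = e^{At} (xk + Z(t) B u).  Along phi the quantity
   J(xi) - alpha (V(xk) - V(phi xi)) is the integral over [0, xi] of a continuous
   rate whose value at 0 is, by the Lyapunov equation,
   (1 - alpha) xk^T (Q + Ft^T R Ft) xk.  Since alpha > 1 this is negative for
   xk != 0, so the constraint holds on a short interval (for xk = 0 the rate
   vanishes identically).  Uniqueness for the linear ODE makes the interval serve
   every trajectory in (P1), and expanding phi in the quadratic forms shows that the
   constraint of (P3) at f = vec Ft is this same quantity. *)
Require Import Defs.
From HB Require Import structures.
From mathcomp Require Import all_boot all_order all_algebra.
From mathcomp Require Import all_classical all_reals all_analysis.
From mathcomp Require Import complex mxtens ring.
Import Order.TTheory GRing.Theory Num.Theory numFieldTopology.Exports numFieldNormedType.Exports.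
Local Open Scope ring_scope.

(** * Scalar power series with coefficients bounded by K C^k / k! *)

Section ExponentialTypeSeries.
Context {R : realType}.
Implicit Types (c : nat -> R) (K C x : R).

(** The terms are dominated by [|K|] times the exponential series at [|C| * |x|], so convergence is
    absolute at every x. *)
Lemma is_cvg_pseries_fact c K C x :
  (forall k, `|c k| <= K * C ^+ k / k`!%:R) -> cvgn (pseries c x).
Proof.
move=> cK; apply: normed_cvg; rewrite /normed_series_of /=.
apply: (@series_le_cvg _ _ (fun k => `|K| * exp_coeff (`|C| * `|x|) k)).
- by move=> k.
- by move=> k; rewrite mulr_ge0// /exp_coeff /= divr_ge0// exprn_ge0// mulr_ge0.
- move=> k /=; rewrite normrM normrX.
  apply: (@le_trans _ _ (`|K * C ^+ k / k`!%:R| * `|x| ^+ k)).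
    by rewrite ler_wpM2r ?exprn_ge0// (le_trans (cK k))// ler_norm.
  rewrite !normrM normfV normrX [`|k`!%:R|]ger0_norm// /exp_coeff /= exprMn.
  by rewrite -!mulrA [_^-1 * _]mulrC.
- by apply: (@is_cvg_seriesZ _ _ `|K|); exact: is_cvg_series_exp_coeff.
Qed.

(** The factor k+1 cancels against (k+1)!, leaving one extra C. The class is thus stable under
    formal differentiation with the same C. *)
Lemma pseries_diffs_fact_bound c K C :
  (forall k, `|c k| <= K * C ^+ k / k`!%:R) ->
  forall k, `|pseries_diffs c k| <= (K * C) * C ^+ k / k`!%:R.
Proof.
move=> cK k; rewrite /pseries_diffs normrM normr_nat.
have -> : K * C * C ^+ k / k`!%:R = k.+1%:R * (K * C ^+ k.+1 / k.+1`!%:R).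
  rewrite factS natrM exprS; field.
  by rewrite nat1r !pnatr_eq0 -lt0n fact_gt0.
by rewrite ler_wpM2l.
Qed.

Lemma is_derive_pseries_fact c K C x :
  (forall k, `|c k| <= K * C ^+ k / k`!%:R) ->
  is_derive x 1 (fun y => limn (pseries c y)) (limn (pseries (pseries_diffs c) x)).
Proof.
move=> cK; have cK1 := pseries_diffs_fact_bound _ _ _ cK.
have cK2 := pseries_diffs_fact_bound _ _ _ cK1.
(* Termwise differentiation asks for convergence of the series and its first two formal derivatives
   at a point beyond [|x|]. *)
apply: (@pseries_snd_diffs _ _ (`|x| + 1)).
- exact: is_cvg_pseries_fact cK.
- exact: is_cvg_pseries_fact cK1.
- exact: is_cvg_pseries_fact cK2.
- by rewrite [ltRHS]ger0_norm ?addr_ge0// ltrDl.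
Qed.

Lemma pseries_fact_antiderivative c K C :
  0 <= K -> 0 <= C -> (forall k, `|c k| <= K * C ^+ k / k`!%:R) ->
  exists f : R -> R,
    f 0 = 0 /\ forall x, is_derive x 1 f (limn (pseries c x)).
Proof.
move=> K0 C0 cK.
pose a k := if k is l.+1 then c l / l.+1%:R else 0.
(* With base 1 + C, at least 1, powers grow with the exponent, so the index shift keeps the bound
   even when C < 1. *)
have aK k : `|a k| <= (K * (1 + C)) * (1 + C) ^+ k / k`!%:R.
  case: k => [|k] /=.
    by rewrite normr0 expr0 fact0 divr1 mulr1 mulr_ge0// addr_ge0.
  rewrite normrM normfV normr_nat factS natrM [k.+1%:R * _]mulrC invfM mulrA.
  rewrite ler_wpM2r ?invr_ge0//.
  apply: (le_trans (cK k)); rewrite ler_wpM2r ?invr_ge0//.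
  rewrite -!mulrA ler_wpM2l// -exprS.
  apply: (@le_trans _ _ ((1 + C) ^+ k)).
    by rewrite lerXn2r ?nnegrE ?addr_ge0// lerDr.
  by apply: ler_weXn2l; rewrite ?lerDl// -addn2 leq_addr.
have -> : c = pseries_diffs a.
  by apply/funext => k; rewrite /pseries_diffs /a mulrC divfK.
exists (fun x => limn (pseries a x) - limn (pseries a 0)).
split; first by rewrite subrr.
move=> x; have da := @is_derive_pseries_fact _ _ _ x aK.
apply: is_derive_eq; last exact: subr0.
Qed.

End ExponentialTypeSeries.

(** * Entrywise differentiation and continuity of matrix functions *)

Definition mxderive {R : realType} {p q : nat} (M : R -> 'M[R]_(p, q)) (t : R)
  (D : 'M[R]_(p, q)) : Prop :=
  forall i j, is_derive t 1 (fun s => M s i j) (D i j).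

Definition mxcontinuous {R : realType} {p q : nat} (M : R -> 'M[R]_(p, q)) : Prop :=
  forall i j, continuous (fun s => M s i j).

Section MatrixCalculus.
Context {R : realType}.
Implicit Types t : R.

Lemma mxderive_eq p q (M : R -> 'M[R]_(p, q)) t D D' :
  mxderive M t D -> D = D' -> mxderive M t D'.
Proof. by move=> MD <-. Qed.

Lemma mxderive_cst p q (C : 'M[R]_(p, q)) t : mxderive (fun=> C) t 0.
Proof. by move=> i j; rewrite mxE; exact: is_derive_cst. Qed.

Lemma mxderiveD p q (M N : R -> 'M[R]_(p, q)) t D E :
  mxderive M t D -> mxderive N t E -> mxderive (fun s => M s + N s) t (D + E).
Proof.
move=> MD NE i j; rewrite mxE.
rewrite (_ : (fun s => _) = (fun s => M s i j) + (fun s => N s i j)).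
  exact: is_deriveD.
by apply/funext => s; rewrite mxE.
Qed.

Lemma mxderiveN p q (M : R -> 'M[R]_(p, q)) t D :
  mxderive M t D -> mxderive (fun s => - M s) t (- D).
Proof.
move=> MD i j; rewrite mxE.
rewrite (_ : (fun s => _) = - (fun s => M s i j)); first exact: is_deriveN.
by apply/funext => s; rewrite mxE.
Qed.

Lemma mxderiveM p q r (M : R -> 'M[R]_(p, q)) (N : R -> 'M[R]_(q, r)) t D E :
  mxderive M t D -> mxderive N t E ->
  mxderive (fun s => M s *m N s) t (D *m N t + M t *m E).
Proof.
move=> MD NE i j.
rewrite (_ : (fun s => _) = \sum_(k < q) ((fun s => M s i k) * (fun s => N s k j))).
  have dS : is_derive t 1 (\sum_(k < q) ((fun s => M s i k) * (fun s => N s k j)))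
      (\sum_(k < q) (M t i k *: E k j + N t k j *: D i k)).
    by apply: is_derive_sum => k; exact: is_deriveM.
  apply: is_derive_eq dS _.
  rewrite !mxE -big_split /=; apply: eq_bigr => k _.
  by rewrite addrC [_ *: D _ _]mulrC.
by apply/funext => s; rewrite mxE fct_sumE.
Qed.

Lemma mxderiveZ p q (M : R -> 'M[R]_(p, q)) c t D :
  mxderive M t D -> mxderive (fun s => c *: M s) t (c *: D).
Proof.
move=> MD; have := mxderiveM _ _ _ _ _ _ _ _ (mxderive_cst _ _ c%:M t) MD.
rewrite mul0mx add0r mul_scalar_mx.
by under eq_fun do rewrite mul_scalar_mx.
Qed.

Lemma mxderive_tr p q (M : R -> 'M[R]_(p, q)) t D :
  mxderive M t D -> mxderive (fun s => (M s)^T) t D^T.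
Proof.
move=> MD i j; rewrite mxE (_ : (fun s => _) = (fun s => M s j i))//.
by apply/funext => s; rewrite mxE.
Qed.

Lemma mxderive_opp p q (M : R -> 'M[R]_(p, q)) t D :
  mxderive M (- t) D -> mxderive (fun s => M (- s)) t (- D).
Proof.
move=> MD i j.
have := @is_derive1_comp _ (fun s => M s i j) -%R t _ _ (MD i j) (is_deriveNid _ _).
by rewrite mulrN1 mxE.
Qed.

Lemma mxderive0_cst p q (M : R -> 'M[R]_(p, q)) s t :
  (forall x, mxderive M x 0) -> M s = M t.
Proof.
move=> M0; apply/matrixP => i j.
apply: (@is_derive_0_is_cst _ (fun s => M s i j)) => x.
by have := M0 x i j; rewrite mxE.
Qed.

Lemma mxderive_continuous p q (M : R -> 'M[R]_(p, q)) D :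
  (forall t, mxderive M t (D t)) -> mxcontinuous M.
Proof.
move=> MD i j t.
by apply/differentiable_continuous/derivable1_diffP/ex_derive/(MD t i j).
Qed.

Lemma mxcontinuous_cst p q (C : 'M[R]_(p, q)) : mxcontinuous (fun=> C).
Proof. by move=> i j t; exact: cvg_cst. Qed.

Lemma mxcontinuousD p q (M N : R -> 'M[R]_(p, q)) :
  mxcontinuous M -> mxcontinuous N -> mxcontinuous (fun s => M s + N s).
Proof.
move=> cM cN i j; under eq_fun do rewrite mxE.
by move=> t; apply: cvgD; [exact: cM|exact: cN].
Qed.

Lemma mxcontinuousZ p q (M : R -> 'M[R]_(p, q)) c :
  mxcontinuous M -> mxcontinuous (fun s => c *: M s).
Proof.
move=> cM i j; under eq_fun do rewrite mxE.
by move=> t; apply: cvgM; [exact: cvg_cst|exact: cM].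
Qed.

Lemma mxcontinuousM p q r (M : R -> 'M[R]_(p, q)) (N : R -> 'M[R]_(q, r)) :
  mxcontinuous M -> mxcontinuous N -> mxcontinuous (fun s => M s *m N s).
Proof.
move=> cM cN i j; under eq_fun do rewrite mxE.
move=> t; apply: cvg_big => [|k _]; first exact: add_continuous.
by apply: cvgM; [exact: cM|exact: cN].
Qed.

Lemma mxcontinuous_tr p q (M : R -> 'M[R]_(p, q)) :
  mxcontinuous M -> mxcontinuous (fun s => (M s)^T).
Proof. by move=> cM i j; under eq_fun do rewrite mxE; exact: cM. Qed.

End MatrixCalculus.

(** * The matrix exponential: derivative, inverse, antiderivative *)

Section MatrixExponential.
Context {R : realType} {n : nat}.
Implicit Types (A : 'M[R]_n) (t : R).

(** The sum C of all absolute entries dominates every absolute row sum, so each further factor A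
    costs at most a factor C. *)
Lemma exprmx_entry_bound A :
  exists2 C : R, 0 <= C & forall k i j, `|(A ^+ k) i j| <= C ^+ k.
Proof.
exists (\sum_i \sum_j `|A i j|); first by do 2!apply: sumr_ge0 => ? _.
set C := \sum_i _; have C0 : 0 <= C by do 2!apply: sumr_ge0 => ? _.
elim=> [|k IH] i j; first by rewrite expr0 mxE; case: eqP; rewrite ?normr1// normr0.
rewrite exprS mxE (le_trans (ler_norm_sum _ _ _))// exprS.
apply: (@le_trans _ _ ((\sum_l `|A i l|) * C ^+ k)).
  rewrite mulr_suml; apply: ler_sum => l _.
  by rewrite normrM ler_wpM2l.
rewrite ler_wpM2r ?exprn_ge0// /C [leRHS](bigD1 i)//= lerDl.
by do 2!apply: sumr_ge0 => ? _.
Qed.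

Lemma exprmxZ A t k : (t *: A) ^+ k = t ^+ k *: A ^+ k.
Proof.
elim: k => [|k IH]; first by rewrite !expr0 scale1r.
by rewrite !exprS IH -!mulmxE -scalemxAl -scalemxAr scalerA.
Qed.

(** Taylor coefficients in t of the (i, j) entry of e^{At}, which reduce matrix questions to scalar
    series. *)
Definition expm_coeff A i j k : R := (A ^+ k) i j / k`!%:R.

Lemma expm_coeff_bound A i j : exists2 C : R, 0 <= C &
  forall k, `|expm_coeff A i j k| <= 1 * C ^+ k / k`!%:R.
Proof.
have [C C0 cA] := exprmx_entry_bound A; exists C => // k.
by rewrite mul1r normrM normfV normr_nat ler_wpM2r ?invr_ge0.
Qed.

Lemma Emx_pseries A t i j : Emx A t i j = limn (pseries (expm_coeff A i j) t).
Proof.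
rewrite !mxE; congr (limn _); apply/funext => N.
rewrite /pseries /series /= big_mkord summxE; apply: eq_bigr => k _.
by rewrite exprmxZ !mxE /expm_coeff; ring.
Qed.

Lemma mxderive_Emx_limn A t :
  mxderive (Emx A) t
    (\matrix_(i, j) limn (pseries (pseries_diffs (expm_coeff A i j)) t)).
Proof.
move=> i j; rewrite mxE; under eq_fun do rewrite Emx_pseries.
have [C _ cA] := expm_coeff_bound A i j.
exact: is_derive_pseries_fact cA.
Qed.

Lemma pseries_diffs_expm_coeff A i j k :
  pseries_diffs (expm_coeff A i j) k = (A ^+ k.+1) i j / k`!%:R.
Proof.
rewrite /pseries_diffs /expm_coeff factS natrM; field.
by rewrite nat1r !pnatr_eq0 -lt0n fact_gt0.
Qed.

Lemma is_cvg_pseries_expm A i j t : cvgn (pseries (expm_coeff A i j) t).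
Proof.
by have [C _ cA] := expm_coeff_bound A i j; exact: is_cvg_pseries_fact cA.
Qed.

(** The differentiated coefficients are those of A^{k+1} / k!. Splitting off one A on the left in
    the partial sums and passing to the limit gives the product. *)
Lemma mxderive_Emx A t : mxderive (Emx A) t (A *m Emx A t).
Proof.
apply: mxderive_eq (mxderive_Emx_limn A t) _.
apply/matrixP => i j; rewrite mxE [RHS]mxE.
under [RHS]eq_bigr do rewrite Emx_pseries.
apply/cvg_lim => //.
rewrite (_ : pseries _ t = fun N => \sum_l A i l * pseries (expm_coeff A l j) t N).
  apply: cvg_big => [|l _]; first exact: add_continuous.
  apply: cvgM; first exact: cvg_cst.
  exact: is_cvg_pseries_expm.
apply/funext => N; rewrite /pseries /series /=.
under [RHS]eq_bigr do rewrite mulr_sumr.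
rewrite exchange_big /=; apply: eq_bigr => k _.
rewrite pseries_diffs_expm_coeff exprS mxE !mulr_suml; apply: eq_bigr => l _.
by rewrite /expm_coeff; ring.
Qed.

(** Same computation with A split off on the right. Having both forms replaces a proof that A and
    e^{At} commute. *)
Lemma mxderive_Emx_r A t : mxderive (Emx A) t (Emx A t *m A).
Proof.
apply: mxderive_eq (mxderive_Emx_limn A t) _.
apply/matrixP => i j; rewrite mxE [RHS]mxE.
under [RHS]eq_bigr do rewrite Emx_pseries.
apply/cvg_lim => //.
rewrite (_ : pseries _ t = fun N => \sum_l pseries (expm_coeff A i l) t N * A l j).
  apply: cvg_big => [|l _]; first exact: add_continuous.
  apply: cvgM; last exact: cvg_cst.
  exact: is_cvg_pseries_expm.
apply/funext => N; rewrite /pseries /series /=.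
under [RHS]eq_bigr do rewrite mulr_suml.
rewrite exchange_big /=; apply: eq_bigr => k _.
rewrite pseries_diffs_expm_coeff exprSr mxE !mulr_suml; apply: eq_bigr => l _.
by rewrite /expm_coeff; ring.
Qed.

Lemma Emx0 A : Emx A 0 = 1%:M.
Proof.
apply/matrixP => i j; rewrite Emx_pseries; apply/cvg_lim => //.
(* The partial sum with no terms is 0; after the shift by one, all partial sums equal the identity
   entry. *)
rewrite -cvg_shiftS /= (_ : (fun _ => _) = cst ((1%:M : 'M[R]_n) i j)).
  exact: cvg_cst.
apply/funext => N; rewrite /pseries /series /= big_nat_recl//=.
rewrite big1 => [|k _]; first by rewrite /expm_coeff !expr0 fact0 divr1 mulr1 addr0.
by rewrite expr0n mulr0.
Qed.

(** The product has derivative e^{As} A e^{-As} - e^{As} A e^{-As} = 0, so it keeps its value at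
    0. *)
Lemma EmxK A t : Emx A t *m Emx A (- t) = 1%:M.
Proof.
transitivity (Emx A 0 *m Emx A (- 0)); last by rewrite oppr0 Emx0 mul1mx.
apply: (mxderive0_cst _ _ (fun s => Emx A s *m Emx A (- s))) => x.
apply: mxderive_eq.
  apply: mxderiveM; first exact: mxderive_Emx_r.
  by apply: mxderive_opp; exact: mxderive_Emx.
by rewrite mulmxN mulmxA subrr.
Qed.

Lemma mxcontinuous_Emx A : mxcontinuous (Emx A).
Proof. exact: mxderive_continuous (mxderive_Emx A). Qed.

(** Each entry of e^{As} is integrated termwise as a power series. The reflection t |-> - H(- t)
    then gives an antiderivative of e^{-As} on the whole line. *)
Lemma Emx_antiderivative A : exists W : R -> 'M[R]_n,
  W 0 = 0 /\ forall t, mxderive W t (Emx A (- t)).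
Proof.
have /choice[G GE] (ij : 'I_n * 'I_n) : exists f : R -> R,
    f 0 = 0 /\ forall x : R, is_derive x 1 f (Emx A x ij.1 ij.2).
  have [C C0 cA] := expm_coeff_bound A ij.1 ij.2.
  have [f [f0 fE]] := pseries_fact_antiderivative _ _ _ ler01 C0 cA.
  by exists f; split => // x; rewrite Emx_pseries; exact: fE.
pose H t : 'M[R]_n := \matrix_(i, j) G (i, j) t.
exists (fun t => - H (- t)); split.
  apply/matrixP => i j; rewrite !mxE oppr0.
  by have [/= -> _] := GE (i, j); rewrite oppr0.
move=> t; rewrite -[Emx A _]opprK.
apply/mxderiveN/mxderive_opp => i j.
have [_ /(_ (- t)) /= GE'] := GE (i, j).
by under eq_fun do rewrite mxE.
Qed.

End MatrixExponential.

(** * Entrywise integrals of continuous matrix functions *)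

Section MatrixIntegral.
Context {R : realType}.
Implicit Types a b : R.
Local Notation mu := (@lebesgue_measure R).

Lemma continuous_itv_integrable (f : R -> R) a b :
  continuous f -> mu.-integrable `[a, b] (EFin \o f).
Proof.
move=> cf; apply: continuous_compact_integrable; first exact: segment_compact.
exact: continuous_subspaceT.
Qed.

Lemma Rintegral_FTC2 (F f : R -> R) a b :
  a <= b -> continuous f -> (forall t : R, is_derive t 1 F (f t)) ->
  Rintegral mu `[a, b] f = F b - F a.
Proof.
(* The degenerate interval is treated apart, since [continuous_FTC2] requires a < b. *)
rewrite le_eqVlt => /predU1P[->|ab] cf dF.
  by rewrite set_itv1 Rintegral_set1 subrr.
have cF t : {for t, continuous F}.
  by apply/differentiable_continuous/derivable1_diffP; have dFt := dF t; exact: ex_derive.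
rewrite /Rintegral (@continuous_FTC2 _ f F)//.
- exact: continuous_subspaceT.
- split; first by move=> t _; exact: ex_derive.
  + by apply: cvg_at_right_filter; exact: cF.
  + by apply: cvg_at_left_filter; exact: cF.
- by move=> t _; rewrite derive1E derive_val.
Qed.

Lemma eq_mxint p q (F G : R -> 'M[R]_(p, q)) a b :
  (forall s, a <= s <= b -> F s = G s) -> mxint a b F = mxint a b G.
Proof.
move=> FG; apply/matrixP => i j; rewrite !mxE; apply: eq_Rintegral => s.
by rewrite inE /= in_itv /= => /FG ->.
Qed.

Lemma mxint_FTC2 p q (W D : R -> 'M[R]_(p, q)) a b :
  a <= b -> mxcontinuous D -> (forall t, mxderive W t (D t)) ->
  mxint a b D = W b - W a.
Proof.
move=> ab cD dW; apply/matrixP => i j; rewrite !mxE.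
by apply: (Rintegral_FTC2 (fun s => W s i j)) => // t; exact: dW.
Qed.

Lemma mxint_cst p q (C : 'M[R]_(p, q)) a b :
  a <= b -> mxint a b (fun=> C) = (b - a) *: C.
Proof.
move=> ab; rewrite (mxint_FTC2 _ _ (fun s => s *: C))// ?scalerBl//.
  exact: mxcontinuous_cst.
move=> t i j; under eq_fun do rewrite mxE.
have := @is_deriveM _ _ id (cst (C i j)) t 1 1 0 (is_derive_id _ _) (is_derive_cst _ _ _).
by move/is_derive_eq; apply; rewrite scaler0 add0r /= [_ *: _]mulr1.
Qed.

Lemma mxintD p q (F G : R -> 'M[R]_(p, q)) a b :
  mxcontinuous F -> mxcontinuous G ->
  mxint a b (fun s => F s + G s) = mxint a b F + mxint a b G.
Proof.
move=> cF cG; apply/matrixP => i j; rewrite !mxE -RintegralD//.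
- by congr (Rintegral _ _ _); apply/funext => s; rewrite mxE.
- exact/continuous_itv_integrable/cF.
- exact/continuous_itv_integrable/cG.
Qed.

Lemma Rintegral_sum_continuous (I : Type) (r : seq I) (f : I -> R -> R) a b :
  (forall i, continuous (f i)) ->
  Rintegral mu `[a, b] (fun s => \sum_(i <- r) f i s) =
  \sum_(i <- r) Rintegral mu `[a, b] (f i).
Proof.
move=> cf; elim: r => [|i r IH].
  rewrite big_nil; under eq_Rintegral do rewrite big_nil.
  by rewrite Rintegral_cst// mul0r.
rewrite big_cons; under eq_Rintegral do rewrite big_cons.
rewrite RintegralD ?IH//; first exact: continuous_itv_integrable.
apply: continuous_itv_integrable => s.
apply: cvg_big => [|k _]; first exact: add_continuous.
exact: cf.
Qed.

Lemma mxint_mull p q r (C : 'M[R]_(p, q)) (F : R -> 'M[R]_(q, r)) a b :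
  mxcontinuous F -> mxint a b (fun s => C *m F s) = C *m mxint a b F.
Proof.
move=> cF; apply/matrixP => i j; rewrite !mxE.
under eq_Rintegral do rewrite mxE.
rewrite Rintegral_sum_continuous => [|k s]; last first.
  by apply: cvgM; [exact: cvg_cst|exact: cF].
apply: eq_bigr => k _; rewrite mxE RintegralZl//.
exact/continuous_itv_integrable/cF.
Qed.

Lemma mxint_tr p q (F : R -> 'M[R]_(p, q)) a b :
  mxint a b (fun s => (F s)^T) = (mxint a b F)^T.
Proof. by apply/matrixP => i j; rewrite !mxE; under eq_Rintegral do rewrite mxE. Qed.

Lemma mxint_mulr p q r (C : 'M[R]_(q, r)) (F : R -> 'M[R]_(p, q)) a b :
  mxcontinuous F -> mxint a b (fun s => F s *m C) = mxint a b F *m C.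
Proof.
move=> cF; rewrite -[RHS]trmxK trmx_mul -mxint_tr.
rewrite -mxint_mull; last exact: mxcontinuous_tr.
by rewrite -mxint_tr; congr mxint; apply/funext => s; rewrite trmx_mul !trmxK.
Qed.

End MatrixIntegral.

(** * Vectorization, Kronecker products and quadratic forms *)

Section MatrixAlgebra.
Context {R : realType}.

(** Both sides are the Frobenius inner product; [mxtens_index] reindexes the double sum. *)
Lemma trmx_vec_mul m n (F G : 'M[R]_(m, n)) :
  ((vec F)^T *m vec G) 0 0 = \tr (F^T *m G).
Proof.
rewrite mxE /mxtrace.
under [RHS]eq_bigr do rewrite mxE.
rewrite pair_big /= (reindex (@mxtens_index n m)) /=; last first.
  by exists (@mxtens_unindex n m) => k _; [exact: mxtens_indexK|exact: mxtens_unindexK].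
by apply: eq_bigr => -[i j] _; rewrite !mxE mxtens_indexK.
Qed.

Lemma tensmx_vec m n p q (C : 'M[R]_(p, n)) (M : 'M[R]_(q, m)) (F : 'M[R]_(m, n)) :
  (C *t M) *m vec F = vec (M *m F *m C^T).
Proof.
apply/matrixP => k z; case: (mxtens_indexP k) => i j; rewrite !mxE mxtens_indexK /=.
under [RHS]eq_bigr do rewrite !mxE mulr_suml.
rewrite pair_big /= (reindex (@mxtens_index n m)) /=; last first.
  by exists (@mxtens_unindex n m) => l _; [exact: mxtens_indexK|exact: mxtens_unindexK].
apply: eq_bigr => -[l h] _.
by rewrite tensmxE !mxE mxtens_indexK /=; ring.
Qed.

Lemma mxtrace_mul_outer n (M : 'M[R]_(n, n)) (x : 'cV[R]_n) :
  \tr (M *m (x *m x^T)) = (x^T *m M *m x) 0 0.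
Proof. by rewrite mulmxA mxtrace_mulC /mxtrace big_ord1 mulmxA. Qed.

(** Symmetry of S makes the second cross block the transpose of the first, so only three blocks
    occur, matching H0, H1 and H2. *)
Lemma quadform_affine n p q (S : 'M[R]_n) (E : 'M[R]_(n, p)) (K : 'M[R]_(n, q))
    (x : 'cV[R]_p) (u : 'cV[R]_q) :
  S^T = S ->
  (E *m x + K *m u)^T *m S *m (E *m x + K *m u) =
  x^T *m (E^T *m S *m E) *m x + x^T *m (E^T *m S *m K) *m u
  + (u^T *m (E^T *m S *m K)^T *m x + u^T *m (K^T *m S *m K) *m u).
Proof.
move=> ST; rewrite [(_ + _)^T]linearD /= !trmx_mul !trmxK ST.
by rewrite !mulmxDl !mulmxDr !mulmxA.
Qed.

Lemma trmx11 (M : 'M[R]_1) : M^T = M.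
Proof. by apply/matrixP => i j; rewrite mxE !ord1. Qed.

(** Reads the quadratic term of (P3) as a form in the input F x: the Kronecker factor x x^T becomes
    a rank-one factor under the trace, and the 2 in [P1] cancels the half. *)
Lemma tensmx_quad m n (M : 'M[R]_m) (F : 'M[R]_(m, n)) (x : 'cV[R]_n) :
  ((2%:R)^-1 *: ((vec F)^T *m (2%:R *: ((x *m x^T) *t M)) *m vec F)) 0 0 =
  ((F *m x)^T *m M *m (F *m x)) 0 0.
Proof.
rewrite -scalemxAr -scalemxAl scalerA mulVf ?pnatr_eq0// scale1r.
rewrite -[(vec F)^T *m _ *m _]mulmxA tensmx_vec trmx_vec_mul [(x *m _)^T]trmx_mul trmxK.
by rewrite mulmxA mxtrace_mul_outer trmx_mul !mulmxA.
Qed.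

Lemma vec_linear m n (N F : 'M[R]_(m, n)) (x : 'cV[R]_n) :
  ((2%:R *: vec (N *m (x *m x^T)))^T *m vec F) 0 0 =
  2%:R * (x^T *m N^T *m (F *m x)) 0 0.
Proof.
rewrite linearZ /= -scalemxAl mxE trmx_vec_mul; congr (_ * _).
rewrite !trmx_mul trmxK -(mulmxA _ N^T F) mxtrace_mulC mxtrace_mul_outer.
by rewrite !mulmxA.
Qed.

End MatrixAlgebra.

(** * Sampled-data trajectories under a held input *)

Section Trajectory.
Context {R : realType} {n m : nat}.
(* [Zmx A] vanishes on negative times; [W] is its smooth extension to all of [R]. *)
Context (A : 'M[R]_n) (B : 'M[R]_(n, m)) (W : R -> 'M[R]_n).
Context (W0 : W 0 = 0) (dW : forall t, mxderive W t (Emx A (- t))).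

(** The response to a constant input from the zero state: the solution of K' = A K + B with K(0) =
    0. *)
Definition held_gain (t : R) : 'M[R]_(n, m) := Emx A t *m W t *m B.

Definition held_sol (u : 'cV[R]_m) (x0 : 'cV[R]_n) (t : R) : 'cV[R]_n :=
  Emx A t *m x0 + held_gain t *m u.

Lemma mxderive_held_gain t : mxderive held_gain t (A *m held_gain t + B).
Proof.
apply: mxderive_eq.
  apply: mxderiveM; last exact: mxderive_cst.
  by apply: mxderiveM; [exact: mxderive_Emx|exact: dW].
by rewrite mulmx0 addr0 EmxK mulmxDl mul1mx /held_gain !mulmxA.
Qed.

Lemma mxderive_held_sol u x0 t :
  mxderive (held_sol u x0) t (A *m held_sol u x0 t + B *m u).
Proof.
apply: mxderive_eq.
  apply: mxderiveD; apply: mxderiveM.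
  - exact: mxderive_Emx.
  - exact: mxderive_cst.
  - exact: mxderive_held_gain.
  - exact: mxderive_cst.
by rewrite !mulmx0 !addr0 mulmxDl mulmxDr !mulmxA addrA.
Qed.

Lemma held_sol0 u x0 : held_sol u x0 0 = x0.
Proof. by rewrite /held_sol /held_gain W0 Emx0 mulmx0 !mul0mx mul1mx addr0. Qed.

Lemma mxcontinuous_held_gain : mxcontinuous held_gain.
Proof. exact: mxderive_continuous mxderive_held_gain. Qed.

Lemma mxcontinuous_held_sol u x0 : mxcontinuous (held_sol u x0).
Proof. exact: mxderive_continuous (mxderive_held_sol u x0). Qed.

(* Variation of constants: e^{-As} (x - held_sol)(s) has zero derivative. *)
Lemma is_traj_held_sol u x0 x : is_traj A B u x0 x -> x = held_sol u x0.
Proof.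
move=> [x00 dx]; apply/funext => t; apply/eqP; rewrite -subr_eq0; apply/eqP.
pose y s := x s - held_sol u x0 s.
have dy s : mxderive y s (A *m y s).
  apply: mxderive_eq.
    apply: mxderiveD; last exact/mxderiveN/mxderive_held_sol.
    by move=> i j; rewrite ord1; exact: dx.
  by rewrite opprD addrACA subrr addr0 -mulmxBr.
have z0 s : mxderive (fun s => Emx A (- s) *m y s) s 0.
  apply: mxderive_eq.
    by apply: mxderiveM; [exact/mxderive_opp/mxderive_Emx_r|exact: dy].
  by rewrite mulNmx mulmxA addNr.
rewrite -/(y t) -[y t]mul1mx -(EmxK A t) -mulmxA.
rewrite (mxderive0_cst _ _ (fun s => Emx A (- s) *m y s) t 0 z0).
by rewrite /y x00 held_sol0 subrr !mulmx0.
Qed.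

Lemma Zmx_antiderivative t : 0 <= t -> Zmx A t = W t.
Proof.
move=> t0; rewrite /Zmx (mxint_FTC2 _ _ W (fun s => Emx A (- s)))// ?W0 ?subr0//.
apply: mxderive_continuous => s; apply: mxderive_opp; exact: mxderive_Emx.
Qed.

Lemma H1_held_gain Q xi : 0 <= xi ->
  H1 A B Q xi = mxint 0 xi (fun s => (Emx A s)^T *m Q *m held_gain s).
Proof.
move=> xi0; apply: eq_mxint => s /andP[s0 _].
by rewrite Zmx_antiderivative// /held_gain !mulmxA.
Qed.

Lemma H2_held_gain Q Rw xi : 0 <= xi ->
  H2 A B Q Rw xi =
  mxint 0 xi (fun s => (held_gain s)^T *m Q *m held_gain s) + xi *: Rw.
Proof.
move=> xi0; congr (_ + _); apply: eq_mxint => s /andP[s0 _].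
by rewrite Zmx_antiderivative.
Qed.

(** * Running cost and constraint gap along the trajectory *)

Definition stage_cost (Q : 'M[R]_n) (Rw : 'M[R]_m) u x0 (t : R) : 'M[R]_1 :=
  (held_sol u x0 t)^T *m Q *m held_sol u x0 t + u^T *m Rw *m u.

(** Left side minus right side of the constraint of (P1) along [held_sol]. *)
Definition budget_gap Q Rw Pt alpha u x0 xi : R :=
  (mxint 0 xi (stage_cost Q Rw u x0)) 0 0
  + alpha * (Vfun Pt (held_sol u x0 xi) - Vfun Pt x0).

Lemma mxint_stage_cost Q Rw u x0 xi : Q^T = Q -> 0 <= xi ->
  (mxint 0 xi (stage_cost Q Rw u x0)) 0 0 =
  (x0^T *m H0 A Q xi *m x0) 0 0 + 2%:R * (x0^T *m H1 A B Q xi *m u) 0 0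
  + (u^T *m H2 A B Q Rw xi *m u) 0 0.
Proof.
move=> QT xi0; have cE := mxcontinuous_Emx A; have cK := mxcontinuous_held_gain.
have cEE : mxcontinuous (fun s => (Emx A s)^T *m Q *m Emx A s).
  do 2?[apply: mxcontinuousM => //]; last exact: mxcontinuous_cst.
  exact: mxcontinuous_tr.
have cEK : mxcontinuous (fun s => (Emx A s)^T *m Q *m held_gain s).
  do 2?[apply: mxcontinuousM => //]; last exact: mxcontinuous_cst.
  exact: mxcontinuous_tr.
have cKK : mxcontinuous (fun s => (held_gain s)^T *m Q *m held_gain s).
  do 2?[apply: mxcontinuousM => //]; last exact: mxcontinuous_cst.
  exact: mxcontinuous_tr.
have cc := @mxcontinuous_cst R.
have cKE := mxcontinuous_tr _ _ _ cEK.
rewrite (eq_mxint _ _ _ (fun s =>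
    x0^T *m ((Emx A s)^T *m Q *m Emx A s) *m x0
    + x0^T *m ((Emx A s)^T *m Q *m held_gain s) *m u
    + (u^T *m ((Emx A s)^T *m Q *m held_gain s)^T *m x0
       + u^T *m ((held_gain s)^T *m Q *m held_gain s) *m u)
    + u^T *m Rw *m u)); last first.
  by move=> s _; rewrite /stage_cost /held_sol quadform_affine.
have cF p q (C : 'M[R]_(1, p)) (D : 'M[R]_(q, 1)) F :
    mxcontinuous F -> mxcontinuous (fun s => C *m F s *m D).
  by move=> cF; apply: mxcontinuousM => //; exact: mxcontinuousM.
rewrite !mxintD; do ?[exact: cF|exact: cc|apply: mxcontinuousD].
rewrite (mxint_cst _ _ (u^T *m Rw *m u))// subr0.
rewrite !mxint_mulr; do ?[exact: mxcontinuousM].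
rewrite !mxint_mull// (mxint_tr _ _ (fun s => (Emx A s)^T *m Q *m held_gain s)).
rewrite -/(H0 A Q xi) -H1_held_gain// H2_held_gain//.
(* A 1 by 1 matrix equals its transpose, so the two cross terms merge into the factor 2. *)
rewrite -[u^T *m (H1 _ _ _ _)^T *m x0]trmx11 !trmx_mul !trmxK mulmxA.
rewrite mulmxDr mulmxDl -scalemxAr -scalemxAl.
by rewrite !mxE; ring.
Qed.

(** The derivative of [budget_gap] in the horizon: stage cost plus alpha times dV/dt. *)
Definition budget_rate Q Rw Pt alpha u x0 (t : R) : 'M[R]_1 :=
  let x := held_sol u x0 t in
  let dx := A *m x + B *m u in
  stage_cost Q Rw u x0 t + alpha *: (dx^T *m Pt *m x + x^T *m Pt *m dx).

Lemma mxcontinuous_stage_cost Q Rw u x0 : mxcontinuous (stage_cost Q Rw u x0).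
Proof.
have cx := mxcontinuous_held_sol u x0; have cc := @mxcontinuous_cst R.
apply: mxcontinuousD => //; do 2!apply: mxcontinuousM => //.
exact: mxcontinuous_tr.
Qed.

Lemma mxcontinuous_budget_rate Q Rw Pt alpha u x0 :
  mxcontinuous (budget_rate Q Rw Pt alpha u x0).
Proof.
have cx := mxcontinuous_held_sol u x0; have cc := @mxcontinuous_cst R.
have cdx : mxcontinuous (fun t => A *m held_sol u x0 t + B *m u).
  by apply: mxcontinuousD => //; exact: mxcontinuousM.
apply: mxcontinuousD; first exact: mxcontinuous_stage_cost.
apply/mxcontinuousZ/mxcontinuousD; do 2!apply: mxcontinuousM => //;
  exact: mxcontinuous_tr.
Qed.

Lemma budget_gap_integral Q Rw Pt alpha u x0 xi : 0 <= xi ->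
  budget_gap Q Rw Pt alpha u x0 xi =
  Rintegral lebesgue_measure `[0, xi] (fun t => budget_rate Q Rw Pt alpha u x0 t 0 0).
Proof.
move=> xi0.
pose V t := alpha *: ((held_sol u x0 t)^T *m Pt *m held_sol u x0 t).
pose dx t := A *m held_sol u x0 t + B *m u.
pose dV t := alpha *: ((dx t)^T *m Pt *m held_sol u x0 t
                       + (held_sol u x0 t)^T *m Pt *m dx t).
have cx := mxcontinuous_held_sol u x0; have cc := @mxcontinuous_cst R.
have cdx : mxcontinuous dx by apply: mxcontinuousD => //; exact: mxcontinuousM.
have cdV : mxcontinuous dV.
  apply/mxcontinuousZ/mxcontinuousD; do 2!apply: mxcontinuousM => //;
    exact: mxcontinuous_tr.
have VdV t : mxderive V t (dV t).
  apply/mxderiveZ; apply: mxderive_eq.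
    apply: mxderiveM; last exact: mxderive_held_sol.
    apply: mxderiveM; last exact: mxderive_cst.
    by apply: mxderive_tr; exact: mxderive_held_sol.
  by rewrite mulmx0 addr0.
have -> : Rintegral lebesgue_measure `[0, xi]
    (fun t => budget_rate Q Rw Pt alpha u x0 t 0 0) =
    (mxint 0 xi (fun t => stage_cost Q Rw u x0 t + dV t)) 0 0 by rewrite mxE.
rewrite mxintD//; last exact: mxcontinuous_stage_cost.
rewrite mxE (mxint_FTC2 _ _ V dV)// /budget_gap; congr (_ + _).
by rewrite /V held_sol0 -scalerBr [RHS]mxE [X in _ = _ * X]mxE [X in _ = _ * (_ + X)]mxE.
Qed.

Lemma budget_rate0 Q Rw Pt alpha F x0 :
  (A + B *m F)^T *m Pt + Pt *m (A + B *m F) + Q + F^T *m Rw *m F = 0 ->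
  budget_rate Q Rw Pt alpha (F *m x0) x0 0 =
  (1 - alpha) *: (x0^T *m Q *m x0 + (F *m x0)^T *m Rw *m (F *m x0)).
Proof.
move=> lyap; rewrite /budget_rate /stage_cost held_sol0.
set g := x0^T *m Q *m x0 + _.
have -> : A *m x0 + B *m (F *m x0) = (A + B *m F) *m x0 by rewrite mulmxDl mulmxA.
move: (A + B *m F) lyap => M lyap.
(* At time 0 the held input agrees with the feedback, so the Lyapunov equation, taken as a quadratic
   form at x0, gives dV/dt = - g. *)
suff -> : (M *m x0)^T *m Pt *m x0 + x0^T *m Pt *m (M *m x0) = - g.
  by rewrite scalerN scalerBl scale1r.
apply/eqP; rewrite -addr_eq0; apply/eqP.
transitivity (x0^T *m (M^T *m Pt + Pt *m M + Q + F^T *m Rw *m F) *m x0).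
  by rewrite /g !trmx_mul !mulmxDr !mulmxDl !mulmxA !addrA.
by rewrite lyap mulmx0 mul0mx.
Qed.

Lemma budget_gap_le0 Q Rw Pt alpha F x0 : posdef Q -> posdef Rw ->
  (A + B *m F)^T *m Pt + Pt *m (A + B *m F) + Q + F^T *m Rw *m F = 0 ->
  1 < alpha ->
  exists2 delta : R, 0 < delta & forall xi, 0 <= xi <= delta ->
    budget_gap Q Rw Pt alpha (F *m x0) x0 xi <= 0.
Proof.
move=> [_ Qpos] [_ Rpos] lyap alpha1.
set u := F *m x0; pose k t := budget_rate Q Rw Pt alpha u x0 t 0 0.
have ck : continuous k by exact: mxcontinuous_budget_rate.
(* By monotonicity of the integral, a nonpositive rate on [0, delta] suffices. *)
suff [delta delta0 kle0] : exists2 delta : R, 0 < delta &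
    forall t, 0 <= t <= delta -> k t <= 0.
  exists delta => // xi /andP[xi0 xid]; rewrite budget_gap_integral//.
  rewrite -[leRHS](_ : Rintegral lebesgue_measure `[0, xi] (cst 0) = 0); last first.
    by rewrite Rintegral_cst// mul0r.
  apply: le_Rintegral => //.
  - exact: continuous_itv_integrable.
  - by apply: continuous_itv_integrable => t; exact: cvg_cst.
  - by move=> t; rewrite /= in_itv /= => /andP[t0 txi]; rewrite kle0// t0 (le_trans txi).
have [x00|x0N0] := eqVneq x0 0.
  exists 1 => // t _; rewrite /k /budget_rate /stage_cost /held_sol /u x00.
  by rewrite !(mulmx0, trmx0, mul0mx, addr0, scaler0) mxE.
have k0 : k 0 < 0.
  (* Strictness comes from Q at x0 != 0; the input term is only nonnegative, as F x0 may vanish. *)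
  rewrite /k budget_rate0// mxE nmulr_rlt0 ?subr_lt0// mxE ltr_wpDr ?Qpos//.
  have [->|uN0] := eqVneq (F *m x0) 0; last exact/ltW/Rpos.
  by rewrite mulmx0 mxE.
have /nbhs_ballP[e /= e0 ke] : nbhs (0 : R) (fun t => k t < 0).
  exact: (cvgr_lt _ (ck 0)).
(* Half the radius keeps the closed interval inside the open ball. *)
exists (e / 2); first by rewrite divr_gt0.
move=> t /andP[t0 te]; apply/ltW/ke; rewrite /ball /= sub0r normrN ger0_norm//.
by rewrite (le_lt_trans te)// ltr_pdivrMr// ltr_pMr// ltr1n.
Qed.

(** Both V at the endpoint and the integrated cost expand by [quadform_affine]; collecting terms
    quadratic, linear and constant in u = F x0 gives [P1], [q1] and [r1]. *)
Lemma budget_gap_QCQP Q Rw Pt alpha F x0 xi :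
  Q^T = Q -> Pt^T = Pt -> 0 <= xi ->
  ((2%:R)^-1 *: ((vec F)^T *m P1 A B Q Rw Pt alpha x0 xi *m vec F)
     + (q1 A B Q Pt alpha x0 xi)^T *m vec F) 0 0 + r1 A Q Pt alpha x0 xi
  = budget_gap Q Rw Pt alpha (F *m x0) x0 xi.
Proof.
move=> QT PT xi0; rewrite /budget_gap mxint_stage_cost//.
rewrite mxE tensmx_quad vec_linear /r1 /Vfun {1}/held_sol {1}/held_sol.
rewrite quadform_affine// Zmx_antiderivative//.
set u := F *m x0; set E := Emx A xi; set K := held_gain xi.
rewrite -[B^T *m _ *m _ *m Pt *m E]trmxK -[u^T *m (E^T *m Pt *m K)^T *m x0]trmx11.
have -> : B^T *m (W xi)^T *m E^T = K^T by rewrite /K /held_gain !trmx_mul !mulmxA.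
have -> : E *m W xi *m B = K by [].
clearbody E K.
(* Symmetry of Pt matches the coefficient in [q1] with the cross block of V. *)
have -> : ((H1 A B Q xi)^T + alpha *: ((K^T *m Pt *m E)^T)^T)^T =
    H1 A B Q xi + alpha *: (E^T *m Pt *m K).
  by rewrite [LHS]linearD /= [(alpha *: _)^T]linearZ /= !trmxK !trmx_mul trmxK PT mulmxA.
have -> : (u^T *m (E^T *m Pt *m K)^T *m x0)^T = x0^T *m (E^T *m Pt *m K) *m u.
  by rewrite trmx_mul [(u^T *m _)^T]trmx_mul !trmxK mulmxA.
rewrite !mulmxDr !mulmxDl -!scalemxAr -!scalemxAl mulmxBr mulmxBl.
by rewrite !mxE; ring.
Qed.

End Trajectory.

(** * Feasibility of both problems with the fallback gain *)

Theorem theorem5 (R : realType) (n m : nat)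
  (A : 'M[R]_n) (B : 'M[R]_(n, m)) (Q : 'M[R]_n) (Rw : 'M[R]_m)
  (gamma eta : R) (xk : 'cV[R]_n) (Ft : 'M[R]_(m, n)) (Pt : 'M[R]_n) :
  stabilizable A B ->
  posdef Q -> posdef Rw ->
  0 <= gamma -> 0 <= eta ->
  hurwitz (A + B *m Ft) ->
  posdef Pt ->
  (A + B *m Ft)^T *m Pt + Pt *m (A + B *m Ft) + Q + Ft^T *m Rw *m Ft = 0 ->
  forall alpha : R, 1 < alpha ->
    feasible_P1 A B Q Rw Pt alpha xk /\ feasible_P3 A B Q Rw Pt alpha xk.
Proof.
move=> _ Qpos Rpos _ _ _ [PT _] lyap alpha alpha1.
have [W [W0 dW]] := Emx_antiderivative A.
have [delta delta0 gap] :=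
  budget_gap_le0 A B W W0 dW Q Rw Pt alpha Ft xk Qpos Rpos lyap alpha1.
split.
- exists Ft, delta; split=> // x xtraj xi /[dup] /gap; rewrite /budget_gap mxE.
  (* By uniqueness the given trajectory is [held_sol], so the delta found for it applies. *)
  rewrite (is_traj_held_sol A B W W0 dW _ _ _ xtraj) => le0 _.
  by rewrite -subr_le0 -mulrN opprB.
- exists (vec Ft), delta; split=> // xi /[dup] /gap le0 /andP[xi0 _].
  by rewrite (budget_gap_QCQP A B W W0 dW)//; case: Qpos.
Qed.
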